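(* Let $m,n,q$ be positive integers and let $T \in \mathrm{Inc}^q(m \times n)$ be an increasing tableau of rectangular shape $m \times n$ with entries in $\{1,\dots,q\}$. Then $\mathsf{Frame}(\mathcal{P}^q(T)) = \mathsf{Frame}(T)$, where $\mathcal{P}$ denotes $K$-promotion and $\mathcal{P}^q$ its $q$-fold iterate.
   Context: Partitions are identified with their Ferrers diagrams in English orientation; $m\times n$ denotes the rectangle with $m$ rows and $n$ columns. An increasing tableau of shape $\lambda$ is a filling of the boxes of $\lambda$ by positive integers strictly increasing left to right along rows and top to bottom down columns; $\mathrm{Inc}^q(\lambda)$ is the set of such tableaux with all entries at most $q$. $K$-promotion: consider fillings of $\lambda$ by positive integers and the symbol $\bullet$. For a positive integer $i$, the operator $\mathsf{swap}_i$ acts as follows: consider the set of boxes containing $i$ or $\bullet$ and decompose it into edge-connected components; on a component consisting of a single box do nothing; on each component with at least two boxes simultaneously replace every $i$ by $\bullet$ and every $\bullet$ by $i$. Let $\mathsf{Rep}_{1\to\bullet}$ replace every entry $1$ by $\bullet$, $\mathsf{Rep}_{\bullet\to q+1}$ replace every $\bullet$ by $q+1$, and $\mathsf{Decr}$ decrease every numerical entry by $1$. For $T\in\mathrm{Inc}^q(\lambda)$, $\mathcal{P}(T) := \mathsf{Decr}\circ \mathsf{Rep}_{\bullet\to q+1}\circ \mathsf{swap}_q\circ\cdots\circ\mathsf{swap}_2\circ \mathsf{Rep}_{1\to\bullet}(T)$, which lies in $\mathrm{Inc}^q(\lambda)$; $\mathcal{P}$ is a bijection of $\mathrm{Inc}^q(\lambda)$.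 The frame $\mathsf{Frame}(\lambda)$ is the set of boxes lying in the first row, the last row, the first column, or the last column of $\lambda$; $\mathsf{Frame}(T)$ is the restriction of the filling $T$ to these boxes. *)

(* Defs.v *)
From mathcomp Require Import all_boot.

Set Implicit Arguments.
Unset Strict Implicit.
Unset Printing Implicit Defensive.

(* Boxes are indexed from 0: (i, j) is in row i from the top and column j from
   the left. *)
Notation box m n := ('I_m * 'I_n)%type.

Definition filling (m n : nat) := {ffun box m n -> nat}.

(* In a filling with bullets, [None] stands for the bullet. *)
Definition bfilling (m n : nat) := {ffun box m n -> option nat}.

Definition increasing (m n : nat) (T : filling m n) : Prop :=
  (forall (i : 'I_m) (j j' : 'I_n), j < j' -> T (i, j) < T (i, j')) /\
  (forall (i i' : 'I_m) (j : 'I_n), i < i' -> T (i, j) < T (i', j)).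

Definition Inc (m n q : nat) (T : filling m n) : Prop :=
  increasing T /\ forall b : box m n, 1 <= T b <= q.

Definition edge_adjacent (m n : nat) : rel (box m n) :=
  [rel b c : box m n |
       (b.1 == c.1) && ((b.2.+1 == c.2 :> nat) || (c.2.+1 == b.2 :> nat))
    || (b.2 == c.2) && ((b.1.+1 == c.1 :> nat) || (c.1.+1 == b.1 :> nat))].

Section KPromotion.

Variables m n : nat.
Implicit Types (U : bfilling m n) (T : filling m n) (b c : box m n).

Definition swap_support (i : nat) U : {set box m n} :=
  [set b | (U b == Some i) || (U b == None)].

(* Meaningful for [b] in [swap_support i U]; for other boxes it is [set b]. *)
Definition swap_component (i : nat) U b : {set box m n} :=
  [set c | connect [rel c d | [&& c \in swap_support i U,
                                 d \in swap_support i U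
                               & edge_adjacent c d]] b c].

Definition swap (i : nat) U : bfilling m n :=
  [ffun b => if (b \in swap_support i U) && (1 < #|swap_component i U b|)
             then (if U b == None then Some i else None)
             else U b].

Definition rep_one_bullet T : bfilling m n :=
  [ffun b => if T b == 1 then None else Some (T b)].

Definition rep_bullet (k : nat) U : filling m n := [ffun b => odflt k (U b)].

Definition decr T : filling m n := [ffun b => (T b).-1].

(* [iota 2 q.-1] is the sequence 2, ..., q, so that [swap 2] acts first. *)
Definition Kpromotion (q : nat) T : filling m n :=
  decr (rep_bullet q.+1
    (foldl (fun U i => swap i U) (rep_one_bullet T) (iota 2 q.-1))).

End KPromotion.

Definition frame (m n : nat) : {set box m n} :=
  [set b : box m n | [|| b.1 == 0 :> nat, b.1 == m.-1 :> nat,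
               b.2 == 0 :> nat | b.2 == n.-1 :> nat]].

Definition Frame (m n : nat) (T : filling m n) :
  {ffun {b : box m n | b \in frame m n} -> nat} :=
  [ffun b => T (val b)].

(* Main.v *)
Require Import Defs.
From mathcomp Require Import all_boot zify.

(* The boxes of the [i]-th promotion of [T] with entries at most [j - i] form a
   growth diagram, in which each unit square obeys a local rule symmetric in its
   two middle corners. Let [k <= q]. Sliding the entries greater than [k] of [T]
   into straight shape preserves the length of the longest strictly increasing
   subsequence of the reading word. For the skew tableau inside the rectangle
   this length is the number of entries greater than [k] in the last row; for
   the straight tableau it is the length of the first row. This relates the last
   row of [T] to the first rows of the shapes in column [q] of the diagram.
   Reflecting the diagram exchanges first and last rows, transposing it exchanges
   rows and columns, and two consecutive triangles give the period [q]. *)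

Set Implicit Arguments.
Unset Strict Implicit.
Unset Printing Implicit Defensive.

(** * Lower sets, strips and the local rule of a square *)

Section LocalRule.

Variables m n : nat.
Implicit Types (A B K L M N : {set box m n}) (b c : box m n).

Definition covers : rel (box m n) :=
  [rel b c : box m n | (b.1 == c.1) && (b.2.+1 == c.2 :> nat)
                    || (b.2 == c.2) && (b.1.+1 == c.1 :> nat)].

Lemma edge_adjacentE b c : edge_adjacent b c = covers b c || covers c b.
Proof.
rewrite /edge_adjacent /covers /= (eq_sym c.1) (eq_sym c.2) !andb_orr.
by rewrite -!orbA; congr (_ || _); rewrite orbCA.
Qed.

Lemma edge_adjacentC b c : edge_adjacent b c = edge_adjacent c b.
Proof. by rewrite !edge_adjacentE orbC. Qed.

Lemma edge_adjacent_irr b : edge_adjacent b b = false.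
Proof. by rewrite edge_adjacentE /covers /= !eqxx /=; lia. Qed.

Definition lower A := forall b c, covers b c -> c \in A -> b \in A.

(** For lower sets, [B :\: A] is convex, so forbidding adjacent boxes already forbids two boxes in
    one row or column. *)
Definition strip A B :=
  A \subset B /\
  forall b c, edge_adjacent b c -> b \in B :\: A -> c \notin B :\: A.

Definition linked A b := [exists c in A, edge_adjacent b c].

(* [K], [L], [M], [N] are the corners of a square of the growth diagram, with
   [K] the smallest and [N] the largest; the rule is symmetric in [L], [M]. *)
Definition local_rule K L M N :=
  forall b, b \in N :\: K -> (b \in M) = ((b \in L) == linked (N :\: K) b).

Lemma local_ruleC K L M N : local_rule K L M N -> local_rule K M L N.
Proof. by move=> H b /H ->; case: (b \in L); case: linked. Qed.

Lemma linkedP A b c : c \in A -> edge_adjacent b c -> linked A b.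
Proof. by move=> cA bc; apply/existsP; exists c; rewrite cA. Qed.

Section Square.

Variables K L M N : {set box m n}.
Hypotheses (loK : lower K) (loL : lower L) (loN : lower N).
Hypotheses (sKL : strip K L) (sLN : strip L N) (rule : local_rule K L M N).

(** Adjacent boxes of [N :\: K] are neither both in [L :\: K] nor both in [N :\: L], so [L]
    two-colours each component. *)
Lemma square_memL b c : edge_adjacent b c -> b \in N :\: K -> c \in N :\: K ->
  (c \in L) = (b \notin L).
Proof.
move=> bc; rewrite !inE => /andP[bK bN] /andP[cK cN].
have := sKL.2 _ _ bc; have := sLN.2 _ _ bc.
rewrite !inE bK bN cK cN !andbT /=.
by case: (b \in L); case: (c \in L) => // h1 h2;
  first [have := h1 isT | have := h2 isT].
Qed.

Lemma square_memM b c : edge_adjacent b c -> b \in N :\: K -> c \in N :\: K ->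
  (b \in M) = (b \in L).
Proof. by move=> bc bD cD; rewrite rule // (linkedP cD bc) eqb_id. Qed.

Hypotheses (KM : K \subset M) (MN : M \subset N).

Lemma square_lower : lower M.
Proof.
move=> b c bc cM; have [bK|bK] := boolP (b \in K); first exact: (subsetP KM).
have cN := subsetP MN _ cM; have bN := loN bc cN.
have cK : c \notin K by apply: contra bK; apply: loK.
have adj : edge_adjacent b c by rewrite edge_adjacentE bc.
have bD : b \in N :\: K by rewrite inE bK.
have cD : c \in N :\: K by rewrite inE cK.
(* Being linked, [c] lies in [L] as it does in [M]; then so does [b], against the alternation of
   [L]. *)
have cL : c \in L.
  by rewrite -(square_memM (b := c) (c := b)) // edge_adjacentC.
by have := square_memL adj bD cD; rewrite cL (loL bc cL).
Qed.

Lemma square_strips : strip K M /\ strip M N.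
Proof.
have sub := subsetP MN; have sub' := subsetP KM.
split; split=> // b c bc; rewrite !inE => /andP[b1 b2].
  apply/negP=> /andP[c1 c2].
  have bD : b \in N :\: K by rewrite inE b1 sub.
  have cD : c \in N :\: K by rewrite inE c1 sub.
  have := square_memL bc bD cD.
  rewrite -(square_memM bc bD cD) -(square_memM (b := c) (c := b)) //.
    by rewrite b2 c2.
  by rewrite edge_adjacentC.
apply/negP=> /andP[c1 c2].
have bD : b \in N :\: K by rewrite inE b2 andbT; apply: contra b1; apply: sub'.
have cD : c \in N :\: K by rewrite inE c2 andbT; apply: contra c1; apply: sub'.
have := square_memL bc bD cD.
rewrite -(square_memM bc bD cD) -(square_memM (b := c) (c := b)) //.
  by rewrite (negPf b1) (negPf c1).
by rewrite edge_adjacentC.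
Qed.

End Square.

End LocalRule.

(** * Promotion as a sequence of local rules *)

Section Promotion.

Variables m n : nat.
Implicit Types (U : bfilling m n) (T : filling m n) (b c : box m n).

Definition level T (k : nat) : {set box m n} := [set b | T b <= k].

Definition numeric U (k : nat) : {set box m n} :=
  [set b | if U b is Some e then e <= k else false].

Definition increasing_on_covers (q : nat) T :=
  (forall b c, covers b c -> T b < T c) /\ forall b, 1 <= T b <= q.

Lemma Inc_covers q T : Inc q T -> increasing_on_covers q T.
Proof.
case=> -[inc_row inc_col] bnd; split=> // -[i j] [i' j'] /=.
case/orP=> /andP[/eqP /= <- /eqP /= lt]; first by apply: inc_row; lia.
by apply: inc_col; lia.
Qed.

(** A path leaving [b] starts with a neighbour in the support, so the size condition on components
    is local. *)
Lemma swap_component_gt1 i U b : b \in swap_support i U ->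
  (1 < #|swap_component i U b|) = linked (swap_support i U) b.
Proof.
move=> bS; apply/card_gt1P/existsP => [[x [y [xC yC xy]]]|[c /andP[cS bc]]].
  have [z zC zb] : exists2 z, z \in swap_component i U b & z != b.
    by have [xb|] := eqVneq x b; [exists y; rewrite // -xb eq_sym | exists x].
  move: zC; rewrite inE => /connectP[[|d p] /=].
    by move=> _ /eqP; rewrite (negPf zb).
  by case/andP=> /and3P[_ dS bd] _ _; exists d; rewrite dS.
exists b, c; split; rewrite ?inE ?connect0 //.
  by apply: connect1; rewrite /= bS cS.
by apply: contraTneq bc => ->; rewrite edge_adjacent_irr.
Qed.

Lemma swapE i U b : swap i U b =
  if (b \in swap_support i U) && linked (swap_support i U) b then
    (if U b == None then Some i else None) else U b.
Proof.
rewrite ffunE; have [bS|//] := boolP (b \in _).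
by rewrite swap_component_gt1.
Qed.

Lemma lower_level q T k : increasing_on_covers q T -> lower (level T k).
Proof. by case=> inc _ b c /inc bc; rewrite !inE; lia. Qed.

Lemma strip_level q T k : increasing_on_covers q T ->
  strip (level T k) (level T k.+1).
Proof.
case=> inc _; split; first by apply/subsetP=> b; rewrite !inE; lia.
by move=> b c; rewrite edge_adjacentE => /orP[] /inc; rewrite !inE; lia.
Qed.

(* The state of the promotion of [T] after [swap_k]. *)
Definition swapped_up_to T k U :=
  [/\ forall b, k < T b -> U b = Some (T b),
      forall b, T b <= k -> if U b is Some e then 2 <= e <= k else true,
      lower (numeric U k) & strip (numeric U k) (level T k)].

Lemma swap_step q T k U : increasing_on_covers q T ->
  swapped_up_to T k U -> 0 < k ->
  let V := swap k.+1 U in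
  [/\ swapped_up_to T k.+1 V, forall j, j <= k -> numeric V j = numeric U j,
      strip (numeric U k) (numeric V k.+1)
    & local_rule (numeric U k) (level T k) (numeric V k.+1) (level T k.+1)].
Proof.
move=> incT [Ugt Ule loU sU] k0 V.
(* Bullets fill [level T k :\: numeric U k], and the entries [k.+1] are still where [T] has them, so
   the support is the difference of the extreme corners. *)
have suppE : swap_support k.+1 U = level T k.+1 :\: numeric U k.
  apply/setP=> b; rewrite !inE.
  have [Tk|Tk] := leqP (T b) k.
    move: (Ule _ Tk); case: (U b) => [e|] /= He; last by rewrite eqxx; lia.
    by rewrite orbF (inj_eq Some_inj); lia.
  by rewrite (Ugt _ Tk) orbF (inj_eq Some_inj); lia.
have suppN b : b \in swap_support k.+1 U -> (U b == None) = (b \in level T k).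
  move=> bS; rewrite inE; have [Tk|Tk] := leqP (T b) k.
    move: bS (Ule _ Tk); rewrite !inE; case: (U b) => [e|] //=.
    by rewrite orbF (inj_eq Some_inj); lia.
  by rewrite (Ugt _ Tk).
have suppV b : b \in swap_support k.+1 U ->
    V b = if (b \in level T k) == linked (swap_support k.+1 U) b
          then Some k.+1 else None.
  move=> bS; rewrite /V swapE bS /= suppN //.
  case: linked; case bL: (b \in level T k) => //=.
    by apply/eqP; rewrite suppN.
  by move: (bS); rewrite inE suppN // bL orbF => /eqP.
have suppVN b : b \notin swap_support k.+1 U -> V b = U b.
  by move=> bS; rewrite /V swapE (negPf bS).
have rule :
  local_rule (numeric U k) (level T k) (numeric V k.+1) (level T k.+1).
  move=> b; rewrite -suppE => bS; rewrite [in LHS]inE suppV //.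
  by case: ifP => // _; rewrite leqnn.
have stab j : j <= k -> numeric V j = numeric U j.
  move=> jk; apply/setP=> b; rewrite !inE.
  have [bS|/suppVN -> //] := boolP (b \in swap_support k.+1 U).
  rewrite suppV //; move: bS; rewrite !inE.
  case: (U b) => [e|] /=; last by case: ifP; lia.
  by rewrite orbF => /eqP [->]; case: ifP; lia.
have KM : numeric U k \subset numeric V k.+1.
  rewrite -(stab k) //; apply/subsetP=> b; rewrite !inE.
  by case: (V b) => // e; lia.
have MN : numeric V k.+1 \subset level T k.+1.
  apply/subsetP=> b bV.
  have [bS|bS] := boolP (b \in swap_support k.+1 U).
    by move: bS; rewrite suppE inE => /andP[].
  move: bV; rewrite !inE suppVN //.
  by have [Tk|Tk] := leqP (T b) k; [lia | rewrite (Ugt _ Tk)].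
have sT := strip_level k incT.
have loV := square_lower loU (lower_level (k:=k) incT)
  (lower_level (k:=k.+1) incT) sU sT rule KM MN.
have [sKM sMN] := square_strips sU sT rule KM MN.
split=> //; split=> // b Tb.
  by rewrite suppVN ?Ugt ?(ltnW Tb) // suppE !inE leqNgt Tb andbF.
have [bS|bS] := boolP (b \in swap_support k.+1 U).
  by rewrite suppV //; case: ifP => //; lia.
rewrite suppVN //; move: bS; rewrite suppE !inE Tb andbT negbK.
have [Tk|Tk] := leqP (T b) k; last by rewrite (Ugt _ Tk); lia.
by move: (Ule _ Tk); case: (U b) => // e; lia.
Qed.

Definition bullet_state T (j : nat) : bfilling m n :=
  foldl (fun U i => swap i U) (rep_one_bullet T) (iota 2 j).

Lemma bullet_stateS T j :
  bullet_state T j.+1 = swap j.+2 (bullet_state T j).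
Proof.
by rewrite /bullet_state -[in LHS](addn1 j) iotaD foldl_cat.
Qed.

Lemma bullet_stateP q T j : increasing_on_covers q T ->
  swapped_up_to T j.+1 (bullet_state T j).
Proof.
move=> incT; elim: j => [|j IH]; last first.
  by rewrite bullet_stateS; case: (swap_step incT IH isT).
have T1 b : T b <= 1 -> T b = 1 by case/andP: (incT.2 b); lia.
have num0 : numeric (bullet_state T 0) 1 = set0.
  apply/setP=> b; rewrite !inE ffunE.
  by case: eqP => //; case/andP: (incT.2 b); lia.
split=> [b Tb|b /T1 Tb||].
- by rewrite ffunE ifF //; lia.
- by rewrite ffunE Tb.
- by move=> b c _; rewrite num0 inE.
rewrite num0; split; first exact: sub0set.
move=> b c; rewrite edge_adjacentE => bc.
rewrite !inE /= => /T1 Tb; apply/negP => /T1 Tc.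
by case/orP: bc => /incT.1; lia.
Qed.

Lemma numeric_bullet_state q T j i : increasing_on_covers q T -> i <= j ->
  numeric (bullet_state T j) i.+1 = numeric (bullet_state T i) i.+1.
Proof.
move=> incT; elim: j => [|j IH]; first by case: i.
rewrite leq_eqVlt => /predU1P[-> //|ij].
have [_ stab _ _] := swap_step incT (bullet_stateP j incT) isT.
by rewrite bullet_stateS stab ?IH.
Qed.

(** Swaps after [swap k.+1] leave the entries up to [k.+1] in place, [decr] lowers these by one, and
    the final bullets become [q], which exceeds [k]. *)
Lemma level_Kpromotion q T k : increasing_on_covers q T -> k < q ->
  level (Kpromotion q T) k = numeric (bullet_state T k) k.+1.
Proof.
move=> incT kq; rewrite -(numeric_bullet_state (j := q.-1) incT); last by lia.
apply/setP=> b; rewrite !inE !ffunE -/(bullet_state T q.-1).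
by case: (bullet_state T q.-1 b) => [e|] /=; lia.
Qed.

Lemma level_top q T k : increasing_on_covers q T -> q <= k -> level T k = setT.
Proof.
by case=> _ bnd qk; apply/setP=> b; rewrite !inE; case/andP: (bnd b); lia.
Qed.

Lemma level0 q T : increasing_on_covers q T -> level T 0 = set0.
Proof.
by case=> _ bnd; apply/setP=> b; rewrite !inE; case/andP: (bnd b); lia.
Qed.

Lemma strip_Kpromotion q T k : increasing_on_covers q T -> k < q ->
  strip (level (Kpromotion q T) k) (level T k.+1).
Proof.
by move=> incT kq; rewrite level_Kpromotion //; case: (bullet_stateP k incT).
Qed.

Lemma local_rule_Kpromotion q T k : increasing_on_covers q T -> k.+1 < q ->
  local_rule (level (Kpromotion q T) k) (level T k.+1)
             (level (Kpromotion q T) k.+1) (level T k.+2).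
Proof.
move=> incT kq; rewrite !level_Kpromotion ?bullet_stateS //; last by lia.
by case: (swap_step incT (bullet_stateP k incT) isT).
Qed.

Lemma Kpromotion_increasing q T : 0 < q -> increasing_on_covers q T ->
  increasing_on_covers q (Kpromotion q T).
Proof.
move=> q0 incT; set S := Kpromotion q T.
have [Sgt Sle _ _] := bullet_stateP q.-1 incT.
have bndS b : 1 <= S b <= q.
  rewrite !ffunE -/(bullet_state T q.-1).
  have Tb : T b <= q.-1.+1 by case/andP: (incT.2 b); lia.
  by move: (Sle _ Tb); case: (bullet_state T q.-1 b) => [e|] /=; lia.
have topS : level S q = setT.
  by apply/setP=> b; rewrite !inE; case/andP: (bndS b).
have stripS k : k < q -> strip (level S k) (level S k.+1).
  move=> kq; have [kq'|kq'] := ltnP k.+1 q.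
    rewrite !level_Kpromotion ?bullet_stateS //.
    by case: (swap_step incT (bullet_stateP k incT) isT).
  (* At [k.+1 = q] both levels are the whole rectangle, so the strip from [S] to [T] serves. *)
  have -> : level S k.+1 = level T k.+1.
    by rewrite (level_top incT) //; have -> : k.+1 = q by lia.
  exact: strip_Kpromotion.
have loS k : lower (level S k).
  have [kq|qk] := ltnP k q.
    by rewrite level_Kpromotion //; case: (bullet_stateP k incT).
  by move=> b c _ _; rewrite inE; case/andP: (bndS b); lia.
split=> // b c bc.
case/andP: (bndS c) => c0 cq; have kq : (S c).-1 < q by lia.
(* If [S b] were not smaller than [S c], then [b] and [c] would be adjacent boxes of one strip. *)
have := (stripS _ kq).2 b c; rewrite edge_adjacentE bc => /(_ isT).
have := loS (S c) _ _ bc; rewrite !inE prednK // leqnn => /(_ isT) Sb.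
by rewrite Sb; lia.
Qed.

End Promotion.

(** * Last passage values and their invariance under slides *)

Section LastPassage.

Variable m : nat.

(** The reading word takes the rows from the bottom up, so a sequence whose largest entry is new in
    row [s] extends one in row [s] and the rows below. *)
Definition passage_step (D a a' : nat -> nat) (r : nat) : nat :=
  \max_(r <= s < m) (D s + (a' s - a s)).

Lemma leq_passage_step D a a' r s : r <= s < m ->
  D s + (a' s - a s) <= passage_step D a a' r.
Proof.
move=> rs; rewrite /passage_step.
by apply: (leq_bigmax_seq (F := fun s => _)); rewrite ?mem_index_iota.
Qed.

Lemma passage_step_leq D a a' r x :
  (forall s, r <= s < m -> D s + (a' s - a s) <= x) ->
  passage_step D a a' r <= x.
Proof.
by move=> H; apply/bigmax_leqP_seq => s; rewrite mem_index_iota => /H.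
Qed.

Lemma passage_stepE D a a' r : r < m ->
  passage_step D a a' r =
  maxn (D r + (a' r - a r)) (passage_step D a a' r.+1).
Proof. by move=> rm; rewrite /passage_step big_ltn. Qed.

Lemma passage_step_out D a a' r : m <= r -> passage_step D a a' r = 0.
Proof. by move=> mr; rewrite /passage_step big_geq. Qed.

Lemma passage_step_anti D a a' r :
  passage_step D a a' r.+1 <= passage_step D a a' r.
Proof. by apply: passage_step_leq => s rs; apply: leq_passage_step; lia. Qed.

(* [passage a t r] is the maximal size of a strictly increasing sequence in the
   reading word of rows [r], ..., [m.-1], restricted to the entries [1..t], of
   the tableau whose boxes with entry at most [t] have row lengths [a t]. *)
Fixpoint passage (a : nat -> nat -> nat) (t : nat) : nat -> nat :=
  if t is t'.+1 then passage_step (passage a t') (a t') (a t) else fun=> 0.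

(* Row lengths in one local square: [b] is the smallest corner, [a] and [b'] the
   middle ones and [a'] the largest. The bullets are the boxes between [b] and
   [a], and the swapped entries those between [a] and [a']. *)
Record slide_rows (a b a' b' : nat -> nat) : Prop := SlideRows {
  slide_a : forall r, a r <= a' r <= (a r).+1;
  slide_b : forall r, b r <= b' r <= (b r).+1;
  slide_out : forall r, m <= r -> a' r = 0;
  slide_interlace : forall r, a r.+1 <= b r /\ a' r.+1 <= b' r;
  slide_up : forall r, a r.+1 < a' r.+1 -> b r = a r.+1 -> b r < b' r;
  slide_stuck : forall r, a r < a' r -> b' r = b r ->
    exists2 s, r = s.+1 & b s = a r;
  slide_down : forall r, b r < b' r -> a' r = a r ->
    a r.+1 < a' r.+1 /\ b r = a r.+1 }.

(* [D] and [E] are the passage values before and after a slide. Only [rel0] is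
   wanted; [rel_slack] and [rel_tight] control how an entry moving up a row can
   make [E r.+1] smaller than [D r.+1] without breaking [rel_interlace]. *)
Record passage_rel (D E a b : nat -> nat) : Prop := PassageRel {
  rel_out : forall r, m <= r -> D r = 0;
  rel0 : D 0 = E 0;
  rel_le : forall r, E r <= D r;
  rel_interlace : forall r, D r.+1 <= E r;
  rel_slack : forall r, E r + a r.+1 <= D r.+1 + b r;
  rel_tight : forall r, E r.+1 < D r.+1 -> D r.+1 + b r <= E r + a r.+1 }.

Lemma passage_rel_step D E a b a' b' : slide_rows a b a' b' ->
  passage_rel D E a b ->
  passage_rel (passage_step D a a') (passage_step E b b') a' b'.
Proof.
move=> [sa sb out il up stuck down] [Dout D0 leED DE slack tight].
set D' := passage_step D a a'; set E' := passage_step E b b'.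
have D'ge r s := @leq_passage_step D a a' r s; rewrite -/D' in D'ge.
have E'ge r s := @leq_passage_step E b b' r s; rewrite -/E' in E'ge.
have D'E r := @passage_stepE D a a' r; rewrite -/D' in D'E.
have E'E r := @passage_stepE E b b' r; rewrite -/E' in E'E.
have D'anti : forall r, D' r.+1 <= D' r by apply: passage_step_anti.
have E'anti : forall r, E' r.+1 <= E' r by apply: passage_step_anti.
have D'out r : m <= r -> D' r = 0 by apply: passage_step_out.
have E'out r : m <= r -> E' r = 0 by apply: passage_step_out.
(* A new entry of row [r.+1] moves up to row [r], or stays and counts in [E'], or [E r.+1] has
   dropped and [tight] gives [E r] the missing unit. *)
have interlace1 r : r.+1 < m -> D r.+1 + (a' r.+1 - a r.+1) <= E' r.
  move=> rm.
  have g1 := E'ge r r.+1 ltac:(lia); have g0 := E'ge r r ltac:(lia).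
  have l1 := leED r.+1; have de := DE r.
  have sa1 := sa r.+1; have sb1 := sb r.+1; have sb0 := sb r.
  have [i1 i2] := il r.
  have [a1|a1] := leqP (a' r.+1) (a r.+1); first by lia.
  have upr : b r = a r.+1 -> b r < b' r by apply: up.
  have [e1|e1] := ltnP (E r.+1) (D r.+1).
    have tr := tight _ e1.
    by have [eq|ne] := eqVneq (b r) (a r.+1); [have := upr eq|]; lia.
  have [b1|b1] := leqP (b' r.+1) (b r.+1); last by lia.
  have [s [<-] bs] := stuck r.+1 a1 ltac:(lia).
  by have := upr bs; lia.
have interlace r : D' r.+1 <= E' r.
  apply: passage_step_leq => -[|s] // rs.
  apply: leq_trans (interlace1 s _) _; first by lia.
  apply: passage_step_leq => u su; apply: E'ge; lia.
have le r : E' r <= D' r.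
  (* An entry that row [s] gains only after the slide comes from row [s.+1], where [D'] counts it;
     there [slack] bounds [E s] by [D s.+1]. *)
  have le1 s : s < m -> E s + (b' s - b s) <= D' s.
    move=> sm; have g := D'ge s s ltac:(lia); have l := leED s.
    have sas := sa s; have sbs := sb s.
    have [b1|b1] := leqP (b' s) (b s); first by lia.
    have [a1|a1] := ltnP (a s) (a' s); first by lia.
    have [a2 eq] := down s b1 ltac:(lia).
    have sm1 : s.+1 < m by rewrite ltnNge; apply/negP => /out; lia.
    by have := D'ge s s.+1 ltac:(lia); have := slack s; lia.
  apply: passage_step_leq => s rs; apply: leq_trans (le1 s _) _; first by lia.
  by apply: passage_step_leq => u su; apply: D'ge; lia.
split=> //.
- apply/eqP; rewrite eqn_leq le andbT.
  have [m0|m0] := posnP m; first by rewrite D'out ?m0.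
  rewrite D'E // geq_max interlace andbT D0.
  apply: leq_trans (E'ge 0 0 _); last by [].
  have sa0 := sa 0; have sb0 := sb 0.
  have [a1|a1] := ltnP (a 0) (a' 0); last by lia.
  have [b1|b1] := ltnP (b 0) (b' 0); first by lia.
  (* An entry of row 0 cannot leave it: [stuck] would provide a row above. *)
  by have [//] := stuck 0 a1 ltac:(lia).
- move=> r; have [i1 i2] := il r.
  have [mr|rm] := leqP m r; first by rewrite E'out //; lia.
  rewrite E'E //; have := le r.+1; have := slack r; have := sb r.
  have sa1 := sa r.+1.
  have : D r.+1 + (a' r.+1 - a r.+1) <= D' r.+1.
    have [mr1|rm1] := leqP m r.+1; last by apply: D'ge; lia.
    by have := out _ mr1; have := Dout _ mr1; lia.
  lia.
- move=> r lt; have rm : r.+1 < m.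
    by rewrite ltnNge; apply/negP => mr; rewrite D'out // in lt.
  have [i1 i2] := il r; have int2 := interlace r.+1; have int1 := interlace r.
  have g0 := E'ge r r ltac:(lia).
  have g1 := E'ge r.+1 r.+1 ltac:(lia).
  (* Since [D' r.+2 <= E' r.+1 < D' r.+1], the maximum giving [D' r.+1] is its first term. *)
  have D'r := D'E _ rm.
  have sa1 := sa r.+1; have sb1 := sb r.+1; have sb0 := sb r.
  have [e1|e1] := ltnP (E r.+1) (D r.+1); first by have := tight _ e1; lia.
  have a1 : a r.+1 < a' r.+1 by lia.
  have [s [<-] bs] := stuck r.+1 a1 ltac:(lia).
  by have := up _ a1 bs; lia.
Qed.

Lemma passage_slide p a b :
  (forall r, a 0 r.+1 <= b 0 r) ->
  (forall t, t < p -> slide_rows (a t) (b t) (a t.+1) (b t.+1)) ->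
  forall t, t <= p -> passage_rel (passage a t) (passage b t) (a t) (b t).
Proof.
move=> ab sl; elim=> [_|t IH tp]; last first.
  by apply: passage_rel_step; [apply: sl | apply: IH; lia].
by split=> // r; rewrite leq_add.
Qed.

Lemma passage_anti a t r s : r <= s -> passage a t s <= passage a t r.
Proof.
case: t => // t rs; apply: passage_step_leq => u su.
by apply: leq_passage_step; lia.
Qed.

(** The part of row [r] beyond [a 0 r] is itself an increasing sequence. *)
Lemma passage_geq a t r : r < m -> a t r <= passage a t r + a 0 r.
Proof.
move=> rm; elim: t => [//|t IH].
have := leq_passage_step (passage a t) (a t) (a t.+1) (r := r) (s := r).
by rewrite leqnn rm => /(_ isT) /=; lia.
Qed.

Section Bounds.

Variables (p : nat) (a : nat -> nat -> nat).
Hypothesis a_mono : forall t r, t < p -> a t r <= a t.+1 r.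
Hypothesis a_anti : forall t r s, t <= p -> r <= s -> a t s <= a t r.

(** In a tableau, a larger entry read later lies in a column further right, so a sequence uses
    distinct columns, all between [a 0 m.-1] and [a t r]. *)
Lemma passage_leq t r : t <= p -> r < m -> passage a t r <= a t r - a 0 m.-1.
Proof.
elim: t r => [//|t IH] r tp rm /=; apply: passage_step_leq => s rs.
have := IH s ltac:(lia) ltac:(lia); have := a_mono s tp.
have := a_anti (s := s) (r := r) tp ltac:(lia).
have := a_anti (t := 0) (s := m.-1) (r := s) ltac:(lia) ltac:(lia).
(* This makes the truncated subtractions exact. *)
suff : a 0 s <= a t s by lia.
have tp' : t <= p by lia.
elim: {rs IH} t tp tp' => // t IH tp tp'.
by apply: leq_trans (a_mono s _); [apply: IH; lia | lia].
Qed.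

End Bounds.

End LastPassage.

(** * Row lengths of lower sets *)

Section RowLength.

Variables m n : nat.
Implicit Types (A B K L M N : {set box m n}) (b c : box m n).

Definition has_box A (r c : nat) :=
  [exists b in A, (b.1 == r :> nat) && (b.2 == c :> nat)].

(** The first missing column, which is the length when the set is lower: [n] for a full row, 0 for
    an index beyond the rectangle. *)
Definition row_length A (r : nat) : nat :=
  find (fun j => ~~ has_box A r j) (iota 0 n).

Lemma mem_has_box A b : (b \in A) = has_box A b.1 b.2.
Proof.
apply/idP/existsP => [bA|[c /and3P[cA /eqP/val_inj c1 /eqP/val_inj c2]]].
  by exists b; rewrite bA !eqxx.
by move: cA; rewrite (surjective_pairing c) c1 c2 -surjective_pairing.
Qed.

Lemma has_boxP A r (c : nat) :
  reflect (exists b, [/\ b \in A, b.1 = r :> nat & b.2 = c :> nat])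
          (has_box A r c).
Proof.
apply: (iffP existsP) => [[b /and3P[bA /eqP ? /eqP ?]]|[b [bA <- <-]]].
  by exists b.
by exists b; rewrite bA !eqxx.
Qed.

Lemma coversP b c :
  reflect ((b.1 = c.1 :> nat /\ b.2.+1 = c.2) \/
           (b.2 = c.2 :> nat /\ b.1.+1 = c.1)) (covers b c).
Proof.
apply: (iffP orP) => [[] /andP[/eqP -> /eqP ->]|[] []].
- by left.
- by right.
- by move=> /val_inj -> ->; left; rewrite !eqxx.
- by move=> /val_inj -> ->; right; rewrite !eqxx.
Qed.

Lemma has_box_row A r (c c' : nat) : lower A -> c' <= c ->
  has_box A r c -> has_box A r c'.
Proof.
move=> loA; elim: c => [|c IH]; first by case: c'.
rewrite leq_eqVlt => /predU1P[-> //|cc] /has_boxP[b [bA b1 b2]].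
apply: IH => //; have cn : c < n by have := ltn_ord b.2; lia.
apply/has_boxP; exists (b.1, Ordinal cn); split=> //=.
by apply: loA bA; apply/coversP; left.
Qed.

Lemma has_box_col A r r' (c : nat) : lower A -> r' <= r ->
  has_box A r c -> has_box A r' c.
Proof.
move=> loA; elim: r => [|r IH]; first by case: r'.
rewrite leq_eqVlt => /predU1P[-> //|rr] /has_boxP[b [bA b1 b2]].
apply: IH => //; have rm : r < m by have := ltn_ord b.1; lia.
apply/has_boxP; exists (Ordinal rm, b.2); split=> //=.
by apply: loA bA; apply/coversP; right.
Qed.

Lemma row_length_leq A r : row_length A r <= n.
Proof.
by have := find_size (fun j => ~~ has_box A r j) (iota 0 n); rewrite size_iota.
Qed.

Lemma has_boxE A r (c : nat) : lower A -> has_box A r c = (c < row_length A r).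
Proof.
move=> loA; apply/idP/idP => [Ac|cl].
  rewrite ltnNge; apply/negP => lc.
  have cn : c < n by case/has_boxP: Ac => b [_ _ <-].
  have ln : row_length A r < size (iota 0 n) by rewrite size_iota; lia.
  have := nth_find 0 (a := fun j => ~~ has_box A r j) (s := iota 0 n).
  rewrite has_find ln => /(_ isT); rewrite -/(row_length A r).
  rewrite nth_iota ?add0n; last by lia.
  by rewrite (has_box_row loA lc Ac).
have := before_find 0 cl; rewrite nth_iota ?add0n; last first.
  by apply: leq_trans cl (row_length_leq _ _).
by move/negbFE.
Qed.

Lemma mem_row_length A b : lower A -> (b \in A) = (b.2 < row_length A b.1).
Proof. by move=> loA; rewrite mem_has_box has_boxE. Qed.

Lemma box_of_row_length A r (c : nat) : lower A -> c < row_length A r ->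
  exists b, [/\ b \in A, b.1 = r :> nat & b.2 = c :> nat].
Proof. by move=> loA; rewrite -has_boxE // => /has_boxP. Qed.

Lemma row_length_out A r : lower A -> m <= r -> row_length A r = 0.
Proof.
move=> loA mr; apply/eqP; rewrite -leqn0 leqNgt; apply/negP.
case/(box_of_row_length loA) => b [_ b1 _].
by have := ltn_ord b.1; lia.
Qed.

Lemma row_length_anti A r s : lower A -> r <= s ->
  row_length A s <= row_length A r.
Proof.
move=> loA rs; rewrite leqNgt; apply/negP => lt.
have : has_box A r (row_length A r).
  by apply: has_box_col rs _; rewrite ?has_boxE.
by rewrite has_boxE // ltnn.
Qed.

Lemma row_length_mono A B r : lower A -> lower B -> A \subset B ->
  row_length A r <= row_length B r.
Proof.
move=> loA loB /subsetP AB; rewrite leqNgt; apply/negP.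
case/(box_of_row_length loA) => b [bA b1 b2].
by have := AB _ bA; rewrite mem_row_length // b1 b2 ltnn.
Qed.

Lemma row_length_set0 r : row_length set0 r = 0.
Proof.
have lo0 : lower (set0 : {set box m n}) by move=> b c _; rewrite inE.
apply/eqP; rewrite -leqn0 leqNgt; apply/negP.
by case/(box_of_row_length lo0) => b [/[!inE]].
Qed.

Lemma row_length_setT r : r < m -> row_length setT r = n.
Proof.
move=> rm; have loT : lower [set: box m n] by move=> b c _; rewrite !inE.
apply/eqP; rewrite eqn_leq row_length_leq leqNgt; apply/negP => lt.
have := mem_row_length (Ordinal rm, Ordinal lt) loT.
by rewrite inE /= ltnn.
Qed.

Lemma row_length_strip A B r : lower A -> lower B -> strip A B ->
  row_length B r <= (row_length A r).+1.
Proof.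
move=> loA loB [_ sAB]; rewrite leqNgt; apply/negP => lt.
have [b [bB b1 b2]] := box_of_row_length loB (ltnW lt).
have [c [cB c1 c2]] := box_of_row_length loB lt.
have bc : edge_adjacent b c.
  by rewrite edge_adjacentE; apply/orP; left; apply/coversP; left; lia.
have := sAB _ _ bc; rewrite !inE bB cB !mem_row_length // b1 b2 c1 c2.
by rewrite !andbT; lia.
Qed.

(** Otherwise column [row_length A r] has boxes of [B :\: A] in both rows. *)
Lemma row_length_interlace A B r : lower A -> lower B -> strip A B ->
  row_length B r.+1 <= row_length A r.
Proof.
move=> loA loB [_ sAB]; rewrite leqNgt; apply/negP => lt.
have [b [bB b1 b2]] :=
  box_of_row_length loB (leq_trans lt (row_length_anti loB (leqnSn r))).
have [c [cB c1 c2]] := box_of_row_length loB lt.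
have bc : edge_adjacent b c.
  by rewrite edge_adjacentE; apply/orP; left; apply/coversP; right; lia.
have := sAB _ _ bc; rewrite !inE bB cB !mem_row_length // b1 b2 c1 c2.
by have := row_length_anti loA (leqnSn r); lia.
Qed.

Lemma slide_rows_square K L M N :
  lower K -> lower L -> lower M -> lower N ->
  strip K L -> strip L N -> strip K M -> strip M N -> local_rule K L M N ->
  slide_rows m (row_length L) (row_length K) (row_length N) (row_length M).
Proof.
move=> loK loL loM loN sKL sLN sKM sMN rule.
have memL := square_memL sKL sLN; have memM := square_memM rule.
have KL := subsetP sKL.1; have MN := subsetP sMN.1.
have inND b : b \in N -> b \notin K -> b \in N :\: K.
  by move=> bN bK; rewrite inE bK.
split.
- by move=> r; rewrite row_length_mono ?row_length_strip // sLN.1.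
- by move=> r; rewrite row_length_mono ?row_length_strip // sKM.1.
- by move=> r; apply: row_length_out.
- by move=> r; rewrite !row_length_interlace.
(* [x] is a new entry and the box [y] above it a bullet; being linked, [y] joins [M]. *)
- move=> r lt eq.
  have [x [xN x1 x2]] := box_of_row_length loN lt.
  have lt' : row_length L r.+1 < row_length N r.
    by apply: leq_trans lt (row_length_anti loN (leqnSn r)).
  have [y [yN y1 y2]] := box_of_row_length loN lt'.
  have adj : edge_adjacent y x.
    by rewrite edge_adjacentE; apply/orP; left; apply/coversP; right; lia.
  have xL : x \notin L by rewrite mem_row_length // x1 x2 ltnn.
  have yD : y \in N :\: K by rewrite inND // mem_row_length // y1 y2 eq ltnn.
  have xD : x \in N :\: K by rewrite inND //; apply: contra xL; apply: KL.
  have : y \in M.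
    by rewrite (memM _ _ adj) //; apply: contraNT xL; rewrite (memL _ _ adj).
  by rewrite mem_row_length // y1 y2 -eq.
(* An isolated [x] would be in [M], so it has a bullet neighbour [y], to the left or above; on the
   left, [y] would make row [r] longer in [M] than in [K]. *)
- move=> r lt eq.
  have [x [xN x1 x2]] := box_of_row_length loN lt.
  have xL : x \notin L by rewrite mem_row_length // x1 x2 ltnn.
  have xM : x \notin M.
    by rewrite mem_row_length // x1 x2 eq -leqNgt row_length_mono ?sKL.1.
  have xD : x \in N :\: K by rewrite inND //; apply: contra xL; apply: KL.
  have := rule _ xD; rewrite (negPf xL) (negPf xM) => /esym/eqP.
  case lk : linked => // _.
  case/existsP: lk => y /andP[yD adj].
  have yL : y \in L by rewrite (memL _ _ adj).
  have yK : y \notin K by move: yD; rewrite inE => /andP[].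
  have yM : y \in M by rewrite (memM y x) // edge_adjacentC.
  move: adj; rewrite edge_adjacentE => /orP[/loL/(_ yL)|].
    by rewrite (negPf xL).
  move: yL yK yM; rewrite !mem_row_length // -leqNgt => yL yK yM.
  case/coversP => -[e1 e2].
    by move: yK yM; rewrite e1 x1 eq; lia.
  exists y.1; first by rewrite -x1 -e2.
  have := row_length_interlace y.1 loK loL sKL.
  by move: yK; rewrite e1 x2 e2 x1 => h1 h2; apply/anti_leq; rewrite h1 h2.
(* The bullet [x] is swapped, so an entry lies to its right or below; the right is excluded because
   row [r] of [N] is no longer than that of [L]. *)
- move=> r lt eq.
  have [x [xM x1 x2]] := box_of_row_length loM lt.
  have xN := MN _ xM.
  have xL : x \in L by move: xN; rewrite !mem_row_length // x1 eq.
  have xD : x \in N :\: K by rewrite inND // mem_row_length // x1 x2 ltnn.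
  have := rule _ xD; rewrite xL xM => /esym/eqP lk.
  have /existsP[y /andP[yD adj]] : linked (N :\: K) x by rewrite -lk.
  have yL : y \notin L by rewrite (memL _ _ adj) // xL.
  have yN : y \in N by move: yD; rewrite inE => /andP[].
  move: adj; rewrite edge_adjacentE => /orP[|/loL/(_ xL)]; last first.
    by rewrite (negPf yL).
  move: yL yN; rewrite !mem_row_length // -leqNgt => yL yN.
  case/coversP => -[e1 e2].
    by move: yL yN; rewrite -e1 x1 eq; lia.
  have st := row_length_strip r.+1 loL loN sLN.
  by move: yL yN; rewrite -e1 x2 -e2 x1; lia.
Qed.

End RowLength.

(** * Growth diagrams and their symmetries *)

(* In the growth diagram of a tableau [T], [G i j] is the set of boxes of the
   [i]-th promotion of [T] with entries at most [j - i]. *)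
Record growth (m n q : nat) (G : nat -> nat -> {set box m n}) : Prop := Growth {
  growth_diag : forall i, i <= q -> G i i = set0;
  growth_full : G 0 q = setT;
  growth_lower : forall i j, i <= j <= q -> lower (G i j);
  growth_right : forall i j, i <= j -> j < q -> strip (G i j) (G i j.+1);
  growth_up : forall i j, i < j -> j <= q -> strip (G i.+1 j) (G i j);
  growth_rule : forall i j, i < j -> j < q ->
    local_rule (G i.+1 j) (G i j) (G i.+1 j.+1) (G i j.+1) }.

(** Reflection keeps the extreme corners of each square and exchanges the middle ones, as the
    symmetry of the local rule permits. *)
Lemma growth_antitranspose m n q (G : nat -> nat -> {set box m n}) :
  growth q G -> growth q (fun i j => G (q - j) (q - i)).
Proof.
case=> diag full lo right up rule; split.
- by move=> i iq; apply: diag; lia.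
- by rewrite subnn subn0.
- by move=> i j ij; apply: lo; lia.
- move=> i j ij jq; have -> : q - j = (q - j.+1).+1 by lia.
  by apply: up; lia.
- move=> i j ij jq; have -> : q - i = (q - i.+1).+1 by lia.
  by apply: right; lia.
- move=> i j ij jq; apply: local_ruleC.
  have -> : q - j = (q - j.+1).+1 by lia.
  have -> : q - i = (q - i.+1).+1 by lia.
  by apply: rule; lia.
Qed.

Section Transpose.

Variables m n : nat.

Definition transpose (A : {set box m n}) : {set box n m} :=
  [set b | (b.2, b.1) \in A].

Lemma covers_swap (b c : box n m) :
  covers (b.2, b.1) (c.2, c.1) = covers b c.
Proof. by rewrite /covers /= orbC. Qed.

Lemma edge_adjacent_swap (b c : box n m) :
  edge_adjacent (b.2, b.1) (c.2, c.1) = edge_adjacent b c.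
Proof. by rewrite !edge_adjacentE !covers_swap. Qed.

Lemma transpose_lower A : lower A -> lower (transpose A).
Proof. by move=> loA b c; rewrite -covers_swap !inE => /loA. Qed.

Lemma transpose_strip A B : strip A B -> strip (transpose A) (transpose B).
Proof.
case=> /subsetP AB sAB; split; first by apply/subsetP=> b; rewrite !inE => /AB.
by move=> b c; rewrite -edge_adjacent_swap => /sAB; rewrite !inE.
Qed.

Lemma transpose_linked A B b :
  linked (transpose B :\: transpose A) b = linked (B :\: A) (b.2, b.1).
Proof.
apply/existsP/existsP => -[c /andP[cD bc]].
  exists (c.2, c.1); move: cD; rewrite !inE => -> /=.
  by rewrite (edge_adjacent_swap b c).
exists (c.2, c.1); move: cD; rewrite !inE -surjective_pairing => -> /=.
by rewrite -edge_adjacent_swap -surjective_pairing.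
Qed.

Lemma transpose_rule K L M N : local_rule K L M N ->
  local_rule (transpose K) (transpose L) (transpose M) (transpose N).
Proof.
move=> rule b; rewrite transpose_linked !inE => bD.
by apply: rule; rewrite inE.
Qed.

Lemma growth_transpose q (G : nat -> nat -> {set box m n}) :
  growth q G -> growth q (fun i j => transpose (G i j)).
Proof.
case=> diag full lo right up rule; split.
- by move=> i iq; apply/setP=> b; rewrite !inE diag // inE.
- by apply/setP=> b; rewrite !inE full inE.
- by move=> i j ij; apply/transpose_lower/lo.
- by move=> i j ij jq; apply/transpose_strip/right.
- by move=> i j ij jq; apply/transpose_strip/up.
- by move=> i j ij jq; apply/transpose_rule/rule.
Qed.

End Transpose.

(** * First and last rows within one triangle *)

Section FrameOfGrowth.

Variables m n q : nat.
Hypothesis m_gt0 : 0 < m.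
Implicit Types G : nat -> nat -> {set box m n}.

(* Both sides compute the last passage value of the skew tableau between [G i k]
   and [G i q], which does not depend on [i <= k]. *)
Lemma last_first_row G k : growth q G -> k <= q ->
  row_length (G 0 k) m.-1 + row_length (G k q) 0 = n.
Proof.
case=> diag full lo right up rule kq.
pose a i t := row_length (G i (k + t)); pose p := q - k.
have mono i t r : i <= k -> t < p -> a i t r <= a i t.+1 r.
  move=> ik tp; rewrite /a; apply: row_length_mono; try by apply: lo; lia.
  by rewrite addnS; apply: (right _ _ _ _).1; lia.
have anti i t r s : i <= k -> t <= p -> r <= s -> a i t s <= a i t r.
  by move=> ik tp; apply: row_length_anti; apply: lo; lia.
have kpq : k + p = q by lia.
(* Passing from [i] to [i.+1] slides the skew tableau once, until at [i = k] its inner shape is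
   empty. *)
have inv i : i <= k -> passage m (a 0) p 0 = passage m (a i) p 0.
  elim: i => [//|i IH] ik; rewrite IH; last by lia.
  apply: (rel0 (passage_slide (p := p) (a := a i) (b := a i.+1) _ _ _)) => //.
    by move=> r; apply: row_length_interlace; first [apply: lo|apply: up]; lia.
  move=> t tp; rewrite /a addnS.
  by apply: slide_rows_square;
    first [apply: lo | apply: up | apply: right | apply: rule]; lia.
have top r : r < m -> a 0 p r = n.
  by move=> rm; rewrite /a kpq full row_length_setT.
have bot r : a k 0 r = 0 by rewrite /a addn0 diag ?row_length_set0.
have a0 : a 0 0 m.-1 = row_length (G 0 k) m.-1 by rewrite /a addn0.
have akp : a k p 0 = row_length (G k q) 0 by rewrite /a kpq.
have m1 : m.-1 < m by lia.
(* At [i = 0] the upper and lower bounds meet at [n] minus the last row of [G 0 k]; at [i = k] they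
   meet at the first row of [G k q]. *)
have le0 := passage_leq (fun t r => mono 0 t r (leq0n k))
  (fun t r s => anti 0 t r s (leq0n k)) (leqnn p) m_gt0.
have ge0 := passage_geq (a 0) p m1.
have lek := passage_leq (fun t r => mono k t r (leqnn k))
  (fun t r s => anti k t r s (leqnn k)) (leqnn p) m_gt0.
have gek := passage_geq (a k) p m_gt0.
have an := passage_anti m (a 0) p (leq0n m.-1).
have len := row_length_leq (G 0 k) m.-1.
have inv' := inv k (leqnn k).
rewrite !top ?bot in le0 ge0 lek gek; try by [].
by lia.
Qed.

(** The reflected diagram has [G k q] and [G 0 k] in exchanged places. *)
Lemma first_last_row G k : growth q G -> k <= q ->
  row_length (G 0 k) 0 + row_length (G k q) m.-1 = n.
Proof.
move=> /growth_antitranspose gG kq.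
have := last_first_row gG (leq_subr k q).
by rewrite subn0 subnn subKn // addnC.
Qed.

End FrameOfGrowth.

(** * The growth diagram of iterated promotion *)

Section PromotionGrowth.

Variables (m n q : nat) (T : filling m n).
Hypotheses (q_gt0 : 0 < q) (incT : increasing_on_covers q T).

Definition promotion_diagram (i j : nat) : {set box m n} :=
  level (iter i (Kpromotion q) T) (j - i).

Lemma iter_Kpromotion_increasing i :
  increasing_on_covers q (iter i (Kpromotion q) T).
Proof. by elim: i => //= i; apply: Kpromotion_increasing. Qed.

(** Every iterate is again an increasing tableau with entries up to [q], so a triangle starts at
    every [s]. *)
Lemma promotion_growth s :
  growth q (fun i j => promotion_diagram (s + i) (s + j)).
Proof.
have inc := iter_Kpromotion_increasing.
rewrite /promotion_diagram; split.
- by move=> i _; rewrite subnn (level0 (inc _)).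
- by rewrite addn0 (level_top (inc s)) // addKn.
- by move=> i j _; apply: lower_level (inc _).
- move=> i j ij jq; have -> : s + j.+1 - (s + i) = (s + j - (s + i)).+1 by lia.
  exact: strip_level (inc _).
- move=> i j ij jq; rewrite addnS iterS.
  have -> : s + j - (s + i) = (s + j - (s + i).+1).+1 by lia.
  by apply: strip_Kpromotion => //; lia.
- move=> i j ij jq; rewrite !addnS iterS.
  have -> : (s + j).+1 - (s + i).+1 = (s + j - (s + i).+1).+1 by lia.
  have -> : s + j - (s + i) = (s + j - (s + i).+1).+1 by lia.
  have -> : (s + j).+1 - (s + i) = (s + j - (s + i).+1).+2 by lia.
  by apply: local_rule_Kpromotion => //; lia.
Qed.

Lemma level_promotion_diagram s k :
  level (iter s (Kpromotion q) T) k = promotion_diagram s (s + k).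
Proof. by rewrite /promotion_diagram addKn. Qed.

End PromotionGrowth.

(** * Periodicity of the frame *)

Section Periodicity.

Variables (m n q : nat) (G : nat -> nat -> {set box m n}).
Hypothesis m_gt0 : 0 < m.
Hypothesis growthG : forall s, growth q (fun i j => G (s + i) (s + j)).

(** The triangles starting at 0 and at [k] share [G k q]: its last row complements to [n] the first
    rows of both [G 0 k] and [G q (q + k)], and its first row complements their last rows. *)
Lemma row_length_period r k : k <= q -> (r == 0) || (r == m.-1) ->
  row_length (G q (q + k)) r = row_length (G 0 k) r.
Proof.
move=> kq; have g0 := growthG 0; have gk := growthG k.
have kqk : k + (q - k) = q by lia.
have lf0 := last_first_row m_gt0 g0 kq.
have fl0 := first_last_row m_gt0 g0 kq.
have lfk := last_first_row m_gt0 gk (leq_subr k q).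
have flk := first_last_row m_gt0 gk (leq_subr k q).
rewrite !add0n in lf0 fl0; rewrite addn0 kqk in lfk flk.
by rewrite (addnC q); case/orP=> /eqP ->; lia.
Qed.

Lemma mem_period (b : box m n) k : k <= q ->
  (b.1 == 0 :> nat) || (b.1 == m.-1 :> nat) ->
  (b \in G q (q + k)) = (b \in G 0 k).
Proof.
move=> kq br; have lo := growth_lower (growthG _).
have lo0 : lower (G 0 k) by apply: (lo 0 0 k).
have loq : lower (G q (q + k)) by rewrite -[q in G q]addn0; apply: lo.
by rewrite !mem_row_length // row_length_period.
Qed.

End Periodicity.

Theorem theorem1p2 (m n q : nat) (T : filling m n) :
  0 < m -> 0 < n -> 0 < q -> Inc q T ->
  Frame (iter q (Kpromotion q) T) = Frame T.
Proof.
move=> m0 n0 q0 /Inc_covers incT.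
have grow := promotion_growth q0 incT.
apply/ffunP=> -[b bF]; rewrite !ffunE /=.
(* Both entries are at most [q], so they agree once the same bounds [k <= q] hold for them. *)
have levelE k : k <= q ->
    (iter q (Kpromotion q) T b <= k) = (T b <= k).
  move=> kq.
  have -> : (iter q (Kpromotion q) T b <= k) =
            (b \in promotion_diagram q T q (q + k)).
    by rewrite -level_promotion_diagram inE.
  have -> : (T b <= k) = (b \in promotion_diagram q T 0 k).
    by rewrite -[k in RHS]add0n -level_promotion_diagram inE.
  move: bF; rewrite inE orbA => /orP[br|bc].
    exact: mem_period grow _ _ _ _.
  (* The first and last columns are the first and last rows of the transposed diagram. *)
  have := mem_period (G := fun i j => transpose (promotion_diagram q T i j)) n0
    (fun s => growth_transpose (grow s)) (b := (b.2, b.1)) kq bc.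
  by rewrite !inE -surjective_pairing.
have [_ Tb] := andP (incT.2 b).
have [_ Sb] := andP ((iter_Kpromotion_increasing q0 incT q).2 b).
by apply/eqP; rewrite eqn_leq levelE // leqnn -levelE // leqnn.
Qed.
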